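(* Let $D\subset\mathbb{C}^n$ be invariant with respect to complex conjugation and let $f\in\mathcal{S}(\Omega_D)$. Then for any $h=1,\dots,n$ one can decompose $$f=f^\circ_{s,h}+\operatorname{Im}(x_h)\odot f'_{s,h},$$ where $\operatorname{Im}(x_h)$ denotes the slice function $x\mapsto\operatorname{Im}(x_h)$; the identity holds on $\Omega_D\setminus\mathbb{R}_h$, and at points of $\Omega_D\cap\mathbb{R}_h$ it holds with the second summand understood to be $0$.
   Context: $\mathbb{H}$ is the algebra of quaternions, $\mathbb{S}_{\mathbb{H}}=\{q\in\mathbb{H}: q^2=-1\}$; $\operatorname{Im}(\alpha+J\beta)=J\beta$ for $\alpha,\beta\in\mathbb{R}$, $J\in\mathbb{S}_{\mathbb{H}}$. $n\ge1$; $\mathcal{P}(n)$ is the set of subsets of $\{1,\dots,n\}$. For $K=\{k_1<\dots<k_p\}\in\mathcal{P}(n)$ and quaternions $q_{k_1},\dots,q_{k_p}$, put $q_K=q_{k_1}\cdots q_{k_p}$ ($q_\emptyset=1$), and $[q_K,a]=q_K\,a$ for $a\in\mathbb{H}$. For $z\in\mathbb{C}^n$, $\overline{z}^h$ is $z$ with its $h$-th coordinate conjugated. $D\subset\mathbb{C}^n$ is invariant with respect to complex conjugation if $z\in D\iff\overline{z}^h\in D$ for every $h$. Its circularization is $\Omega_D=\{(\alpha_l+J_l\beta_l)_{l=1}^n: (\alpha_l+i\beta_l)_{l=1}^n\in D,\ J_1,\dots,J_n\in\mathbb{S}_{\mathbb{H}}\}\subset\mathbb{H}^n$. Let $\{e_K\}_{K\in\mathcal{P}(n)}$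 be a basis of $\mathbb{R}^{2^n}$. A stem function is $F=\sum_{K}e_KF_K:D\to\mathbb{H}\otimes\mathbb{R}^{2^n}$, $F_K:D\to\mathbb{H}$, with $F_K(\overline{z}^h)=(-1)^{|K\cap\{h\}|}F_K(z)$ for all $K,h,z$. $F$ induces the slice function $f=\mathcal{I}(F):\Omega_D\to\mathbb{H}$, $f(x)=\sum_K[J_K,F_K(z)]$ for $x=(\alpha_l+J_l\beta_l)_l$, $z=(\alpha_l+i\beta_l)_l\in D$. $\mathcal{S}(\Omega_D)$ is the set of slice functions; each slice function is induced by a unique stem function. Slice product: for stem functions $F,G$ put $(F\otimes G)(z)=\sum_{H,K\in\mathcal{P}(n)}(-1)^{|H\cap K|}e_{H\Delta K}F_H(z)G_K(z)$ with $H\Delta K=(H\cup K)\setminus(H\cap K)$; this is again a stem function, and $\mathcal{I}(F)\odot\mathcal{I}(G):=\mathcal{I}(F\otimes G)$ (functions being restricted to a common domain when necessary). $\mathbb{R}_h$ denotes the set of points whose $h$-th coordinate is real. For $f=\mathcal{I}(F)$, the spherical $x_h$-value is $f^\circ_{s,h}=\mathcal{I}(F^\circ_h)\in\mathcal{S}(\Omega_D)$, with $F^\circ_h(z)=\sum_{K\in\mathcal{P}(n),\,h\notin K}e_KF_K(z)$, and the spherical $x_h$-derivative is $f'_{s,h}=\mathcal{I}(F'_h)\in\mathcal{S}(\Omega_D\setminus\mathbb{R}_h)$, with $F'_h(z)=\beta_h^{-1}\sum_{K\in\mathcal{P}(n),\,h\notin K}e_KF_{K\cup\{h\}}(z)$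 for $z\in D\setminus\mathbb{R}_h$, $z_h=\alpha_h+i\beta_h$. *)

(* Defs.v *)
From HB Require Import structures.
From mathcomp Require Import all_boot all_order all_algebra.
From mathcomp Require Import boolp classical_sets reals complex ring.
Set Implicit Arguments.
Unset Strict Implicit.
Unset Printing Implicit Defensive.
Import Order.TTheory GRing.Theory Num.Theory.
Local Open Scope classical_set_scope.
Local Open Scope ring_scope.

Record quat (R : Type) : Type :=
  Quat { q_re : R; q_i : R; q_j : R; q_k : R }.

Section QuatChoice.
Variable R : Type.

Definition tuple_of_quat (q : quat R) := (q_re q, q_i q, q_j q, q_k q).
Definition quat_of_tuple (t : R * R * R * R) :=
  let: (a, b, c, d) := t in Quat a b c d.

Lemma tuple_of_quatK : cancel tuple_of_quat quat_of_tuple.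
Proof. by case. Qed.
End QuatChoice.

HB.instance Definition _ (R : eqType) := Equality.copy (quat R)
  (can_type (@tuple_of_quatK R)).
HB.instance Definition _ (R : choiceType) := Choice.copy (quat R)
  (can_type (@tuple_of_quatK R)).

Section QuatAlgebra.
Variable R : comNzRingType.
Implicit Types p q r : quat R.

Definition quat_add p q :=
  Quat (q_re p + q_re q) (q_i p + q_i q) (q_j p + q_j q) (q_k p + q_k q).
Definition quat_opp q := Quat (- q_re q) (- q_i q) (- q_j q) (- q_k q).
Definition quat_mul p q :=
  let: Quat a1 b1 c1 d1 := p in
  let: Quat a2 b2 c2 d2 := q in
  Quat (a1 * a2 - b1 * b2 - c1 * c2 - d1 * d2)
       (a1 * b2 + b1 * a2 + c1 * d2 - d1 * c2)
       (a1 * c2 - b1 * d2 + c1 * a2 + d1 * b2)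
       (a1 * d2 + b1 * c2 - c1 * b2 + d1 * a2).
Definition quat_scale (a : R) q :=
  Quat (a * q_re q) (a * q_i q) (a * q_j q) (a * q_k q).

Fact quat_addA : associative quat_add.
Proof. by case=> ????[????][????]; rewrite /quat_add /= !addrA. Qed.
Fact quat_addC : commutative quat_add.
Proof. by case=> ????[????]; congr Quat; rewrite /= addrC. Qed.
Fact quat_add0 : left_id (Quat 0 0 0 0) quat_add.
Proof. by case=> ????; rewrite /quat_add /= !add0r. Qed.
Fact quat_addN : left_inverse (Quat 0 0 0 0) quat_opp quat_add.
Proof. by case=> ????; rewrite /quat_add /= !addNr. Qed.

HB.instance Definition _ :=
  GRing.isZmodule.Build (quat R) quat_addA quat_addC quat_add0 quat_addN.

Fact quat_mulA : associative quat_mul.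
Proof. by case=> ????[????][????]; congr Quat; ring. Qed.
Fact quat_mul1 : left_id (Quat 1 0 0 0) quat_mul.
Proof. by case=> ????; congr Quat; ring. Qed.
Fact quat_mulr1 : right_id (Quat 1 0 0 0) quat_mul.
Proof. by case=> ????; congr Quat; ring. Qed.
Fact quat_mulDl : left_distributive quat_mul +%R.
Proof. by case=> ????[????][????]; congr Quat => /=; ring. Qed.
Fact quat_mulDr : right_distributive quat_mul +%R.
Proof. by case=> ????[????][????]; congr Quat => /=; ring. Qed.
Fact quat_1_neq0 : Quat 1 0 0 0 != 0 :> quat R.
Proof. by apply/eqP => -[] /eqP; rewrite oner_eq0. Qed.

HB.instance Definition _ := GRing.Zmodule_isNzRing.Build (quat R)
  quat_mulA quat_mul1 quat_mulr1 quat_mulDl quat_mulDr quat_1_neq0.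

Fact quat_scaleA a b q : quat_scale a (quat_scale b q) = quat_scale (a * b) q.
Proof. by case: q => ????; rewrite /quat_scale /= !mulrA. Qed.
Fact quat_scale1 : left_id 1 quat_scale.
Proof. by case=> ????; rewrite /quat_scale /= !mul1r. Qed.
Fact quat_scaleDr : right_distributive quat_scale +%R.
Proof. by move=> ? [????][????]; congr Quat; rewrite /= mulrDr. Qed.
Fact quat_scaleDl q : {morph quat_scale^~ q : a b / a + b}.
Proof. by case: q => ???? a b; congr Quat; rewrite /= mulrDl. Qed.

HB.instance Definition _ := GRing.Zmodule_isLmodule.Build R (quat R)
  quat_scaleA quat_scale1 quat_scaleDr quat_scaleDl.

Fact quat_scaleAl (a : R) p q : a *: (p * q) = (a *: p) * q.
Proof. by case: p q => ????[????]; congr Quat => /=; ring. Qed.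
HB.instance Definition _ := GRing.Lmodule_isLalgebra.Build R (quat R)
  quat_scaleAl.

Fact quat_scaleAr (a : R) p q : a *: (p * q) = p * (a *: q).
Proof. by case: p q => ????[????]; congr Quat => /=; ring. Qed.
HB.instance Definition _ := GRing.Lalgebra_isAlgebra.Build R (quat R)
  quat_scaleAr.

Definition imag_units : set (quat R) := [set q | q ^+ 2 = -1].

Definition quat_Im q : quat R := Quat 0 (q_i q) (q_j q) (q_k q).
End QuatAlgebra.

Lemma quat_ImE (R : realType) (a b : R) (J : quat R) :
  imag_units J -> quat_Im (a%:A + b *: J) = b *: J.
Proof.
case: J => x y z t; rewrite /imag_units /= expr2 => -[h0 h1 h2 h3].
suff -> : x = 0 by congr Quat => /=; ring.
apply/eqP/negPn/negP => x0.
have K (u : R) : x * u + u * x = 0 -> u = 0.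
  move=> /eqP; rewrite [u * x]mulrC -mulr2n mulrn_eq0 /= mulf_eq0.
  by rewrite (negPf x0) => /eqP.
have y0 : y = 0 by apply: K; rewrite -[RHS]oppr0 -h1; ring.
have z0 : z = 0 by apply: K; rewrite -[RHS]oppr0 -h2; ring.
have t0 : t = 0 by apply: K; rewrite -[RHS]oppr0 -h3; ring.
have := sqr_ge0 x; have -> : x ^+ 2 = -1 by rewrite -h0 y0 z0 t0; ring.
by rewrite oppr_ge0 ler10.
Qed.

Section SliceFunctions.
Variables (R : realType) (n : nat).
Local Notation Cn := 'rV[R[i]]_n.
Local Notation Hn := 'rV[quat R]_n.
Implicit Types (D : set Cn) (z : Cn) (J x : Hn) (h : 'I_n) (K : {set 'I_n}).

Definition conj_at h z : Cn :=
  \row_l (if l == h then conjc (z 0 l) else z 0 l).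

Definition conj_invariant D := forall h z, D z <-> D (conj_at h z).

Definition qpoint z J : Hn :=
  \row_l ((complex.Re (z 0 l))%:A + complex.Im (z 0 l) *: J 0 l).

Definition circularization D : set Hn :=
  [set x | exists z J,
     [/\ D z, forall l, imag_units (J 0 l) & x = qpoint z J]].

Definition creal_at h : set Cn := [set z | complex.Im (z 0 h) = 0].
Definition qreal_at h : set Hn := [set x | exists a : R, x 0 h = a%:A].

(* The factors are taken by increasing index, as 'I_n is enumerated in
   increasing order; this matters since quat R is not commutative. *)
Definition qprod x K : quat R := \prod_(k < n | k \in K) x 0 k.

Definition qbracket x K (a : quat R) : quat R := qprod x K * a.

(* H \otimes R^(2^n), in coordinates with respect to the basis (e_K)_K:
   F z K is F_K(z), and ebasis K a is e_K a. *)
Definition qtensor := {ffun {set 'I_n} -> quat R}.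

Definition ebasis K (a : quat R) : qtensor :=
  [ffun L => if L == K then a else 0].

(* Functions with domain D (or circularization D) are represented by total
   functions, whose values outside the domain are irrelevant. *)
Definition stem D (F : Cn -> qtensor) :=
  forall K h z, D z ->
    F (conj_at h z) K = (-1) ^+ #|K :&: [set h]%SET| * F z K.

(* I(F). When D is conj_invariant and F is a stem function, all the pairs
   (z, J) representing x yield the same value; it is 0 outside of
   circularization D. *)
Definition slice_of D (F : Cn -> qtensor) (x : Hn) : quat R :=
  xget 0 [set y | exists z J,
    [/\ D z, forall l, imag_units (J 0 l), x = qpoint z J &
        y = \sum_K qbracket J K (F z K)]].

Definition induces D (F : Cn -> qtensor) (f : Hn -> quat R) :=
  stem D F /\ (forall x, circularization D x -> f x = slice_of D F x).

Definition slice D : set (Hn -> quat R) := [set f | exists F, induces D F f].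

(* The stem function inducing f, unique on D. *)
Definition stem_of D (f : Hn -> quat R) : Cn -> qtensor :=
  xget (fun=> 0) [set F | induces D F f].

Definition stem_mul (F G : Cn -> qtensor) z : qtensor :=
  \sum_(H : {set 'I_n}) \sum_(K : {set 'I_n})
    (-1 : R) ^+ #|H :&: K| *:
      ebasis ((H :|: K) :\: (H :&: K))%SET (F z H * G z K).

(* D is the common domain to which f and g are restricted. *)
Definition slice_mul D (f g : Hn -> quat R) : Hn -> quat R :=
  slice_of D (stem_mul (stem_of D f) (stem_of D g)).

Definition stem_value h (F : Cn -> qtensor) z : qtensor :=
  \sum_(K : {set 'I_n} | h \notin K) ebasis K (F z K).

Definition stem_deriv h (F : Cn -> qtensor) z : qtensor :=
  (complex.Im (z 0 h))^-1 *:
    \sum_(K : {set 'I_n} | h \notin K) ebasis K (F z (h |: K)%SET).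

Definition sph_value D h (f : Hn -> quat R) : Hn -> quat R :=
  slice_of D (stem_value h (stem_of D f)).

Definition sph_deriv D h (f : Hn -> quat R) : Hn -> quat R :=
  slice_of (D `\` creal_at h) (stem_deriv h (stem_of D f)).

Definition Im_at h (x : Hn) : quat R := quat_Im (x 0 h).

End SliceFunctions.

(* Main.v *)
Require Import Defs.
From mathcomp Require Import all_boot all_order all_algebra.
From mathcomp Require Import boolp classical_sets reals complex.
Import GRing.Theory Num.Theory.
Local Open Scope classical_set_scope.
Local Open Scope ring_scope.

(** Write J_K for the ordered product of the J_k with k in K.  At a point x given
by z in D and units J, one has f(x) = sum_K J_K F_K(z), and splitting the sum
according to whether h belongs to K gives the decomposition.  The sets K
without h form the spherical value.  For the others, Im(x_h) is induced by
e_{h} beta_h, whose product with beta_h^-1 e_K F_{K u {h}}, h not in K, is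
e_{K u {h}} F_{K u {h}}: no sign appears because {h} and K are disjoint, and
the tensor product does the reordering, so that the position of J_h inside J_K
never matters.  Hence the stem function of the product is F minus its h-free
part ([stem_mul_Im_deriv]).  When x_h is real, F_K(z) = - F_K(z) for h in K, so
the h-free part is all of F ([stem_real_eq0]).

Two facts make this computation legitimate, since slice functions, products and
derivatives are defined through choices.

- The sum does not depend on the pair (z, J) representing x
  ([slice_sum_wd], [slice_ofE]).  Two representations differ by conjugating z
  and negating J at the same coordinates, and by changing J_l freely where x_l is
  real.  The stem symmetry compensates the former, and the latter only affects
  J_l for sets K with l in K, where F_K(z) = 0.

- The inducing stem function is unique on D ([stem_unique]), so the product may
  be computed from any stem functions inducing its factors.  For fixed z the sum
  is known for all choices of units; changing the signs of the units separates
  the terms J_K F_K(z), and J_K is invertible ([slice_sum_inj]). *)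

(** * Imaginary units and representations of a quaternion *)

Section ImaginaryUnits.
Set Implicit Arguments.
Unset Strict Implicit.
Unset Printing Implicit Defensive.
Variable R : realType.
Implicit Types (a b : R) (J : quat R).

Lemma quat_Im_real a : quat_Im (a%:A : quat R) = 0.
Proof. by congr Quat; rewrite /= mulr0. Qed.

Lemma imag_unitN J : imag_units J -> imag_units (- J).
Proof. by rewrite /imag_units /= sqrrN. Qed.

Lemma imag_unit_neq0 J : imag_units J -> J != 0.
Proof.
move=> hJ; apply/eqP => J0; move: hJ; rewrite /imag_units /= J0 expr0n /=.
by move/eqP; rewrite eq_sym oppr_eq0 oner_eq0.
Qed.

Lemma imag_unit_lreg J : imag_units J -> GRing.lreg J.
Proof.
rewrite /imag_units /= expr2 => hJ u v /(congr1 ( *%R J)).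
by rewrite !mulrA hJ !mulN1r => /oppr_inj.
Qed.

Lemma imag_units_i : imag_units (Quat 0 1 0 0 : quat R).
Proof.
rewrite /imag_units /= expr2; congr Quat => /=;
  by rewrite ?(mul0r, mulr0, mulr1, subr0, addr0, sub0r, oppr0).
Qed.

Lemma scale_imag_unit_eq0 b J : imag_units J -> b *: J = 0 -> b = 0.
Proof.
move=> hJ; case: (eqVneq b 0) => // b0 /(congr1 ( *:%R b^-1)).
rewrite scalerA mulVf // scale1r scaler0 => /eqP.
by rewrite (negPf (imag_unit_neq0 hJ)).
Qed.

(** The real parts agree because the imaginary ones do, and squaring
[b *: J = b' *: J'] gives [b ^+ 2 = b' ^+ 2]; the exponent [b != b'] records
which of the two signs occurs. *)
Lemma quat_repr_eq a b J a' b' J' :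
  imag_units J -> imag_units J' ->
  a%:A + b *: J = a'%:A + b' *: J' ->
  [/\ a = a', b *: J = b' *: J' & b' = (-1) ^+ (b != b') * b].
Proof.
move=> hJ hJ' e; have eI : b *: J = b' *: J'.
  by rewrite -(quat_ImE a b hJ) e quat_ImE.
have inj1 (u v : R) : u *: (1 : quat R) = v *: 1 -> u = v.
  by case; rewrite !mulr1.
split=> //; first by move: e; rewrite eI => /addIr /inj1.
have e2 : b ^+ 2 = b' ^+ 2.
  apply: inj1; apply: oppr_inj; rewrite -!scalerN.
  by rewrite -{1}(hJ : J ^+ 2 = -1) -(hJ' : J' ^+ 2 = -1) -!exprZn eI.
case: eqVneq => [->|nb] /=; first by rewrite expr0 mul1r.
move/eqP: e2; rewrite eqf_sqr (negPf nb) /= => /eqP ->.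
by rewrite expr1 mulN1r opprK.
Qed.

(** Signs are scalars of [R] when they come from negating units, and quaternions
in the definition of stem functions. *)
Lemma scale_signE m (q : quat R) : ((-1 : R) ^+ m) *: q = (-1) ^+ m * q.
Proof.
rewrite -(signr_odd R) -(signr_odd (quat R)).
by case: (odd m); rewrite ?expr0 ?expr1 ?scaleN1r ?mulN1r ?scale1r ?mul1r.
Qed.

End ImaginaryUnits.

(** * Slice functions do not depend on the representation of a point *)

Section Slice.
Set Implicit Arguments.
Unset Strict Implicit.
Unset Printing Implicit Defensive.
Variables (R : realType) (n : nat).
Local Notation Cn := 'rV[R[i]]_n.
Local Notation Hn := 'rV[quat R]_n.
Local Notation Tn := (qtensor R n).
Implicit Types (D : set Cn) (z : Cn) (J x : Hn) (h : 'I_n).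
Implicit Types (A K L : {set 'I_n}) (F G : Cn -> Tn).

Definition unit_frame J := forall l, imag_units (J 0 l).

Definition slice_sum J (a : Tn) : quat R := \sum_K qbracket J K (a K).

(** Two representations of a point differ at several coordinates at once, whence
simultaneous versions of [conj_at] and of negating units. *)
Definition conj_on A z : Cn :=
  \row_l (if l \in A then conjc (z 0 l) else z 0 l).

Definition sign_on A J : Hn := \row_l (((-1 : R) ^+ (l \in A)) *: J 0 l).

Lemma Im_conj_at h l z :
  complex.Im (conj_at h z 0 l) = (-1) ^+ (l == h) * complex.Im (z 0 l).
Proof.
rewrite mxE; case: eqP => _; last by rewrite expr0 mul1r.
by rewrite expr1 mulN1r; case: (z 0 l).
Qed.

Lemma cardsI1 K h : #|K :&: [set h]%SET| = (h \in K).
Proof.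
case: (boolP (h \in K)) => hK.
  by rewrite (finset.setIidPr _) ?cards1 // finset.sub1set.
by apply/eqP; rewrite cards_eq0 setI_eq0 disjoint_sym disjoints1.
Qed.

Lemma prod_sign_on A K :
  \prod_(l in K) ((-1 : R) ^+ (l \in A)) = (-1) ^+ #|K :&: A|.
Proof.
rewrite prodrXr -sum1_card [in RHS]big_mkcond [in LHS]big_mkcond /=.
by congr (_ ^+ _); apply: eq_bigr => l _; rewrite inE; case: (l \in K).
Qed.

Lemma qprod_scale (c : 'I_n -> R) J J' K :
  (forall l, l \in K -> J' 0 l = c l *: J 0 l) ->
  qprod J' K = (\prod_(l in K) c l) *: qprod J K.
Proof.
by move=> e; rewrite /qprod -scaler_prod; apply: eq_bigr => l /e.
Qed.

Lemma sign_on_frame A J : unit_frame J -> unit_frame (sign_on A J).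
Proof.
move=> hJ l; rewrite mxE; case: (l \in A); last by rewrite expr0 scale1r.
by rewrite expr1 scaleN1r; apply: imag_unitN.
Qed.

Lemma qprod_sign_on A J K :
  qprod (sign_on A J) K = (-1) ^+ #|K :&: A| *: qprod J K.
Proof.
rewrite -prod_sign_on; apply: (@qprod_scale (fun l => (-1) ^+ (l \in A))) => l _.
by rewrite mxE.
Qed.

Lemma stem_conj_on D F (D_inv : conj_invariant D) (stF : stem D F) A z :
  D z -> D (conj_on A z) /\
         forall K, F (conj_on A z) K = (-1) ^+ #|K :&: A| * F z K.
Proof.
move=> Dz; have [m] := ubnP #|A|; elim: m A => // m IH A leA.
have [->|[h hA]] := set_0Vmem A.
  have -> : conj_on finset.set0 z = z by apply/rowP=> l; rewrite mxE inE.
  by split=> // K; rewrite finset.setI0 cards0 expr0 mul1r.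
have e : conj_on A z = conj_at h (conj_on (A :\ h)%SET z).
  apply/rowP=> l; rewrite !mxE in_setD1.
  by case: eqVneq => [->|_] //=; rewrite hA.
have [|DA FA] := IH (A :\ h)%SET.
  by move: leA; rewrite (cardsD1 h) hA.
rewrite e; split; first exact: (D_inv h _).1.
move=> K; rewrite stF // FA mulrA -exprD cardsI1; congr (_ ^+ _ * _).
by rewrite (cardsD1 h (K :&: A)%SET) inE hA andbT finset.setIDA.
Qed.

(** Conjugating a real coordinate changes nothing, while the stem symmetry changes
the sign of the components containing it. *)
Lemma stem_real_eq0 D F (stF : stem D F) h K z :
  D z -> complex.Im (z 0 h) = 0 -> h \in K -> F z K = 0.
Proof.
move=> Dz z0 hK; have := stF K h _ Dz.
have -> : conj_at h z = z.
  apply/rowP=> l; rewrite mxE; case: eqP => // ->.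
  by move: z0; case: (z 0 h) => a b /= ->; rewrite /conjc oppr0.
rewrite cardsI1 hK expr1 mulN1r => /eqP; rewrite -addr_eq0 -mulr2n -scaler_nat.
by rewrite scaler_eq0 pnatr_eq0 /= => /eqP.
Qed.

(** The two sums agree term by term.  Let [A] be the set of coordinates where the
imaginary parts differ, so that [z'] is [z] conjugated on [A].  If some
coordinate in [K] is real, both components vanish; otherwise [J'] is [J] negated
on [A] along [K], and the two signs [(-1) ^+ #|K :&: A|] cancel. *)
Lemma slice_sum_wd D F (D_inv : conj_invariant D) (stF : stem D F) z J z' J' :
  D z -> unit_frame J -> unit_frame J' -> qpoint z J = qpoint z' J' ->
  slice_sum J (F z) = slice_sum J' (F z').
Proof.
move=> Dz hJ hJ' e.
pose A : {set 'I_n} := [set l | complex.Im (z 0 l) != complex.Im (z' 0 l)]%SET.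
have rep l : [/\ complex.Re (z 0 l) = complex.Re (z' 0 l),
    complex.Im (z 0 l) *: J 0 l = complex.Im (z' 0 l) *: J' 0 l
    & complex.Im (z' 0 l) = (-1) ^+ (l \in A) * complex.Im (z 0 l)].
  rewrite inE; apply: quat_repr_eq => //.
  by move/rowP: e => /(_ l); rewrite !mxE.
have zA : z' = conj_on A z.
  apply/rowP=> l; rewrite mxE; have [+ _ +] := rep l.
  case: (z 0 l) (z' 0 l) => [a b] [a' b'] /= <- ->.
  by case: (l \in A); rewrite ?expr1 ?mulN1r ?expr0 ?mul1r.
have [Dz' FA] := stem_conj_on D_inv stF A Dz; rewrite zA.
apply: eq_bigr => K _; rewrite FA /qbracket.
have [/existsP[l /andP[lK /eqP zl]]|nr] :=
  boolP [exists l, (l \in K) && (complex.Im (z 0 l) == 0)].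
  by rewrite (stem_real_eq0 stF Dz zl lK) !mulr0.
rewrite (@qprod_scale (fun l => (-1) ^+ (l \in A)) J J' K).
  rewrite prod_sign_on -scale_signE -scalerAl -scalerAr scalerA -exprD.
  by rewrite addnn -mul2n exprM sqrrN !expr1n scale1r.
move=> l lK; have [_ + eb] := rep l; rewrite {}eb.
have zl : complex.Im (z 0 l) != 0.
  by move: nr; rewrite negb_exists => /forallP/(_ l); rewrite lK.
move/(congr1 ( *:%R (complex.Im (z 0 l))^-1)).
rewrite !scalerA mulVf // scale1r => ->.
rewrite scalerA [_^-1 * _]mulrC mulfK // -exprD.
by rewrite addnn -mul2n exprM sqrrN !expr1n scale1r.
Qed.

Lemma slice_ofE D F (D_inv : conj_invariant D) (stF : stem D F) z J :
  D z -> unit_frame J -> slice_of D F (qpoint z J) = slice_sum J (F z).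
Proof.
move=> Dz hJ; rewrite /slice_of; apply: xget_subset1.
  by exists z, J.
move=> y1 y2 [z1 [J1 [D1 h1 e1 ->]]] [z2 [J2 [D2 h2 e2 ->]]].
by apply: (slice_sum_wd D_inv stF) => //; rewrite -e1 -e2.
Qed.

(** * Uniqueness of the inducing stem function *)

(** Negating [J 0 h] changes the sign of exactly the terms with [h \in K].  Adding
or subtracting the two vanishing sums isolates the terms whose [K] agrees with
[K0] at [h]; once this is done for every [h], only [K0] is left. *)
Lemma slice_sum_inj (a : Tn) :
  (forall J, unit_frame J -> slice_sum J a = 0) -> a = 0.
Proof.
move=> a0; apply/ffunP => K0; rewrite ffunE.
pose agree s K := all (fun l => (l \in K) == (l \in K0)) s.
have part s J : unit_frame J -> \sum_(K | agree s K) qbracket J K (a K) = 0.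
  elim: s J => [|h s IH] J hJ; first exact: a0.
  (* [X] and [Y] are the terms agreeing and disagreeing with [K0] at [h]; the two
     sums are X + Y and, up to sign, X - Y. *)
  have S0 := IH _ hJ.
  have := IH _ (sign_on_frame [set h]%SET hJ).
  under eq_bigr do rewrite /qbracket qprod_sign_on -scalerAl -/(qbracket J _ _).
  pose at_h K := (h \in K) == (h \in K0).
  move: S0; rewrite [X in X = 0 -> _](bigID at_h) /=.
  move=> S0; rewrite [X in X = 0 -> _](bigID at_h) /=.
  under [X in X + _ = _ -> _]eq_bigr => K /andP[_ /eqP e].
    rewrite cardsI1 e; over.
  under [X in _ + X = _ -> _]eq_bigr => K /andP[_ e].
    rewrite cardsI1 (_ : (h \in K) = ~~ (h \in K0)); last first.
      by move: e; rewrite /at_h; case: (h \in K); case: (h \in K0).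
    over.
  move: S0; rewrite -!scaler_sumr.
  set X := \sum_(K | _) _; set Y := \sum_(K | _) _.
  move=> /eqP; rewrite addrC addr_eq0 => /eqP -> e.
  rewrite (eq_bigl (fun K => agree s K && at_h K)); last first.
    by move=> K /=; rewrite andbC.
  rewrite -/X; move/eqP: e.
  case: (h \in K0); rewrite /= ?expr0 ?expr1 !scaleN1r !scale1r ?opprK.
    by rewrite -opprD oppr_eq0 -mulr2n -scaler_nat scaler_eq0 pnatr_eq0 => /eqP.
  by rewrite -mulr2n -scaler_nat scaler_eq0 pnatr_eq0 => /eqP.
pose J : Hn := const_mx (Quat 0 1 0 0).
have hJ : unit_frame J by move=> l; rewrite mxE; apply: imag_units_i.
have := part (enum 'I_n) J hJ; rewrite (big_pred1 K0) => [|K]; last first.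
  apply/allP/eqP => [e|-> //]; apply/setP => l.
  by apply/eqP/e; rewrite mem_enum.
have reg : GRing.lreg (qprod J K0).
  apply: (big_ind (@GRing.lreg _)) => [|u v|l _]; first exact: lreg1.
  - exact: lregM.
  - exact: imag_unit_lreg.
by rewrite -[RHS](mulr0 (qprod J K0)) => /reg.
Qed.

(** Evaluating at all [qpoint z J] with [z] fixed reaches every frame [J], even if
coordinates of [z] are real and some of these points coincide, because [slice_ofE] holds
for each representation. *)
Lemma stem_unique D F G f (D_inv : conj_invariant D) :
  induces D F f -> induces D G f -> forall z, D z -> F z = G z.
Proof.
move=> [stF fF] [stG fG] z Dz; apply/eqP; rewrite -subr_eq0; apply/eqP.
apply: slice_sum_inj => J hJ; apply/eqP.
have Ox : circularization D (qpoint z J) by exists z, J.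
rewrite -[X in _ == X](subrr (f (qpoint z J))) {1}fF // fG // !slice_ofE //.
rewrite /slice_sum -sumrB; apply/eqP/eq_bigr => K _.
by rewrite /qbracket !ffunE mulrBr.
Qed.

Lemma induces_stem_of D F f : induces D F f -> induces D (stem_of D f) f.
Proof. by move=> i; apply: (@xgetPex _ _ [set F | induces D F f]); exists F. Qed.

Lemma stem_ofE D F f (D_inv : conj_invariant D) :
  induces D F f -> forall z, D z -> stem_of D f z = F z.
Proof.
by move=> i z; apply: (stem_unique D_inv _ i); apply: induces_stem_of i.
Qed.

(** * The stem functions of the decomposition *)

Lemma sum_ebasisE (P : pred {set 'I_n}) (u : {set 'I_n} -> quat R) L :
  (\sum_(K | P K) ebasis K (u K)) L = if P L then u L else 0.
Proof.
rewrite sum_ffunE; under eq_bigr do rewrite ffunE.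
rewrite -big_mkcondr; case: (boolP (P L)) => PL.
  rewrite (big_pred1 L) // => K.
  by rewrite [L == K]eq_sym /=; case: eqP => [->|]; rewrite ?PL ?andbF.
by apply: big_pred0 => K; case: eqP => [<-|]; rewrite ?(negPf PL) ?andbF.
Qed.

Lemma stem_valueE h F z K :
  stem_value h F z K = if h \notin K then F z K else 0.
Proof. exact: sum_ebasisE. Qed.

Lemma stem_derivE h F z K : stem_deriv h F z K =
  if h \notin K then (complex.Im (z 0 h))^-1 *: F z (h |: K)%SET else 0.
Proof.
rewrite /stem_deriv ffunE (sum_ebasisE _ (fun K => F z (h |: K)%SET)).
by case: ifP => _; rewrite ?scaler0.
Qed.

Lemma stem_value_stem D F h : stem D F -> stem D (stem_value h F).
Proof.
by move=> stF K l z Dz; rewrite !stem_valueE stF //; case: ifP; rewrite ?mulr0.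
Qed.

Lemma stem_sub D D' F : D' `<=` D -> stem D F -> stem D' F.
Proof. by move=> sD stF K l z /sD; apply: stF. Qed.

Lemma conj_invariant_setD_real D h :
  conj_invariant D -> conj_invariant (D `\` creal_at h).
Proof.
move=> D_inv l z; rewrite /creal_at /setD /= Im_conj_at.
have e (b : bool) (r : R) : (-1) ^+ b * r = 0 <-> r = 0.
  rewrite mulr_sign; case: b; last by [].
  by split=> [/eqP|->]; rewrite ?oppr0 // oppr_eq0 => /eqP.
by split=> -[/(D_inv l z) Dz nz]; split=> //; move: nz; rewrite e.
Qed.

(** At the coordinate [h], the signs of [beta_h^-1] and of the component indexed by
[h |: K] cancel, as required of a component whose index omits [h]. *)
Lemma stem_deriv_stem D F h : stem D F -> stem D (stem_deriv h F).
Proof.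
move=> stF K l z Dz; rewrite !stem_derivE stF // Im_conj_at.
case: ifP => [hK|_]; last by rewrite mulr0.
rewrite -!scale_signE !scalerA; congr (_ *: _).
rewrite !cardsI1 !inE; case: (eqVneq l h) => [->|_] /=.
  by rewrite (negPf hK) !expr1 expr0 mulN1r mulrN1 mul1r invrN opprK.
by rewrite expr0 mul1r mulrC.
Qed.

Definition stem_Im h z : Tn :=
  ebasis [set h]%SET ((complex.Im (z 0 h))%:A).

Lemma stem_Im_stem D h : stem D (stem_Im h).
Proof.
move=> K l z _; rewrite !ffunE; case: eqP => [->|_]; last by rewrite mulr0.
by rewrite Im_conj_at -scale_signE scalerA cardsI1 inE eq_sym.
Qed.

Lemma qprod1 J h : qprod J [set h]%SET = J 0 h.
Proof. by rewrite /qprod (big_pred1 h) // => l; rewrite inE. Qed.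

Lemma Im_at_induced D h :
  conj_invariant D -> induces D (stem_Im h) (@Im_at R n h).
Proof.
move=> D_inv; split; first exact: stem_Im_stem.
move=> _ [z [J [Dz hJ ->]]]; rewrite slice_ofE //; last exact: stem_Im_stem.
rewrite /Im_at mxE quat_ImE // /slice_sum (bigD1 [set h]%SET) //= big1.
  by rewrite addr0 /qbracket qprod1 ffunE eqxx -scalerAr mulr1.
by move=> K nK; rewrite ffunE (negPf nK) /qbracket mulr0.
Qed.

(** Only the index [[set h]] contributes in the left factor, and only sets [K]
without [h] in the right one.  So the coefficient [beta_h] cancels [beta_h^-1], the sign is trivial
and the component at [L] comes from [K = L :\ h] when [h \in L], and is zero
otherwise. *)
Lemma stem_mul_Im_deriv h z F G H :
  complex.Im (z 0 h) != 0 -> H z = stem_Im h z -> G z = stem_deriv h F z ->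
  stem_mul H G z = F z - stem_value h F z.
Proof.
move=> z0 eH eG; apply/ffunP=> L; rewrite /stem_mul eH eG.
rewrite (bigD1 [set h]%SET) //= [X in _ + X]big1 ?addr0; last first.
  move=> K nK; apply: big1 => K' _; rewrite ffunE (negPf nK) mul0r.
  by apply/ffunP=> M; rewrite !ffunE; case: ifP; rewrite scaler0.
rewrite sum_ffunE [RHS]ffunE [X in _ + X]ffunE stem_valueE.
rewrite (eq_bigr (fun K => if (h \notin K) && (K == L :\ h)%SET && (h \in L)
                           then F z L else 0)); last first.
  move=> K _; rewrite 2!ffunE [stem_Im _ _ _]ffunE eqxx stem_derivE.
  rewrite -scalerAl mul1r; have [hK|hK] := boolP (h \in K) => /=.
    by rewrite scaler0 if_same scaler0.
  have -> : ([set h] :&: K = finset.set0)%SET.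
    by apply/eqP; rewrite setI_eq0 disjoints1.
  rewrite cards0 expr0 scale1r finset.setD0 scalerA divff // scale1r.
  have [->|nL] := eqVneq L (h |: K)%SET.
    by rewrite finset.setU1K // eqxx setU11.
  case: andP => // -[/eqP eK hL].
  by rewrite eK finset.setD1K // eqxx in nL.
rewrite -big_mkcond; have [hL|hL] := boolP (h \in L) => /=.
  rewrite subr0 (big_pred1 (L :\ h)%SET) // => K; rewrite andbT /=.
  by case: eqP => [->|]; rewrite ?andbF // !inE eqxx.
by rewrite subrr big_pred0 // => K; rewrite andbF.
Qed.

End Slice.

(** * The decomposition *)

Theorem proposition4p6 (R : realType) (n : nat) (n_ge1 : (1 <= n)%N)
    (D : set 'rV[R[i]]_n) (D_inv : conj_invariant D)
    (f : 'rV[quat R]_n -> quat R) (f_slice : slice D f) (h : 'I_n) :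
  (forall x, (circularization D `\` qreal_at h) x ->
     f x = sph_value D h f x
           + slice_mul (D `\` creal_at h) (Im_at h) (sph_deriv D h f) x) /\
  (forall x, (circularization D `&` qreal_at h) x ->
     f x = sph_value D h f x + 0).
Proof.
have [F0 /induces_stem_of[]] := f_slice.
rewrite /sph_value /sph_deriv; set F := stem_of D f => stF fF.
have stV := stem_value_stem h stF.
split=> [x [[z [J [Dz hJ xE]]] nx]|x [[z [J [Dz hJ xE]]] [a xa]]]; last first.
  have z0 : complex.Im (z 0 h) = 0.
    apply: (@scale_imag_unit_eq0 R _ (J 0 h)) => //.
    rewrite -(quat_ImE (complex.Re (z 0 h)) (complex.Im (z 0 h)) (hJ h)).
    by move: xa; rewrite xE mxE => ->; apply: quat_Im_real.
  rewrite addr0 fF; last by exists z, J.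
  rewrite xE !slice_ofE //; apply: eq_bigr => K _.
  rewrite stem_valueE; case: ifPn => // /negPn hK.
  by rewrite (stem_real_eq0 stF Dz z0).
have nz : complex.Im (z 0 h) != 0.
  apply/eqP => z0; apply: nx; exists (complex.Re (z 0 h)).
  by rewrite xE mxE z0 scale0r addr0.
have D'_inv := conj_invariant_setD_real h D_inv.
set D' := D `\` creal_at h in D'_inv *.
have stF' : stem D' F by apply: stem_sub stF => ? [].
have D'z : D' z by split=> // /eqP; rewrite (negPf nz).
have stV' : stem D' (stem_value h F) := stem_value_stem h stF'.
have stFV : stem D' (fun z => F z - stem_value h F z).
  have subE w K : (F w - stem_value h F w) K = F w K - stem_value h F w K.
    by rewrite ffunE [X in _ + X]ffunE.
  by move=> K l w Dw; rewrite !subE stF' // stV' // mulrBr.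
have derI : induces D' (stem_deriv h F) (slice_of D' (stem_deriv h F)).
  by split=> //; apply: stem_deriv_stem.
have prodE w : D' w -> stem_mul (stem_of D' (Im_at h))
    (stem_of D' (slice_of D' (stem_deriv h F))) w = F w - stem_value h F w.
  move=> D'w; apply: stem_mul_Im_deriv.
  - by case: D'w => _ /eqP.
  - by rewrite (stem_ofE D'_inv (Im_at_induced h D'_inv)).
  - by rewrite (stem_ofE D'_inv derI).
have stP : stem D' (stem_mul (stem_of D' (Im_at h))
    (stem_of D' (slice_of D' (stem_deriv h F)))).
  by move=> K l w Dw; rewrite !prodE ?stFV //; exact: (D'_inv _ _).1.
rewrite /slice_mul fF; last by exists z, J.
rewrite xE !slice_ofE // prodE // /slice_sum -big_split /=.
apply: eq_bigr => K _; rewrite /qbracket -mulrDr; congr (_ * _).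
by rewrite !ffunE addrC subrK.
Qed.
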